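(* For a semigroup $S$ the following conditions are equivalent: (1) $S$ is an intra-regular semigroup; (2) for every intuitionistic fuzzy ideal $A=(\mu_A,\nu_A)$ of $S$ (and every $\beta\in(0,1]$ and $\alpha\in[0,\inf_{x\in S}\beta\nu_A(x)]$), the intuitionistic fuzzy magnified translation $A^C_{\beta\alpha}$ of $A$ is an intuitionistic fuzzy semiprime ideal of $S$.
   Context: A semigroup is a non-empty set with an associative binary operation. $S$ is intra-regular if for each $a\in S$ there exist $x,y\in S$ with $a=xa^2y$. An intuitionistic fuzzy subset of $S$ is a pair $A=(\mu_A,\nu_A)$ of functions $\mu_A,\nu_A:S\to[0,1]$ with $0\le\mu_A(x)+\nu_A(x)\le1$ for all $x\in S$; it is non-empty if it is not the empty one ($\mu_A\equiv0$, $\nu_A\equiv1$). For $\beta\in(0,1]$ and $\alpha\in[0,\inf_{x\in S}\beta\nu_A(x)]$, the intuitionistic fuzzy magnified translation of $A$ is $A^C_{\beta\alpha}=((\mu_A)^C_{\beta\alpha},(\nu_A)^C_{\beta\alpha})$ with $(\mu_A)^C_{\beta\alpha}(x)=\beta\mu_A(x)+\alpha$ and $(\nu_A)^C_{\beta\alpha}(x)=\beta\nu_A(x)-\alpha$ for all $x\in S$. A non-empty intuitionistic fuzzy subset $A$ of $S$ is an intuitionistic fuzzy left (resp. right) ideal if $\mu_A(xy)\ge\mu_A(y)$ and $\nu_A(xy)\le\nu_A(y)$ (resp. $\mu_A(xy)\ge\mu_A(x)$ and $\nu_A(xy)\le\nu_A(x)$) for all $x,y\in S$; it is an intuitionistic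 fuzzy ideal if it is both a left and a right one. An intuitionistic fuzzy ideal $A$ is an intuitionistic fuzzy semiprime ideal if $\mu_A(x)\ge\mu_A(x^2)$ and $\nu_A(x)\le\nu_A(x^2)$ for all $x\in S$. *)

(* Defs.v *)
From HB Require Import structures.
From mathcomp Require Import all_boot all_order all_algebra.
From mathcomp Require Import classical_sets reals.

Set Implicit Arguments.
Unset Strict Implicit.
Unset Printing Implicit Defensive.

Import Order.TTheory GRing.Theory Num.Theory.

Local Open Scope classical_set_scope.
Local Open Scope ring_scope.

(* A [semigroupType] may be empty; non-emptiness is a separate hypothesis where
   it is needed. The power [a ^+ 2] is only available with a unit, hence [a * a]. *)
Definition intra_regular (S : semigroupType) : Prop :=
  forall a : S, exists x y : S, a = (x * (a * a) * y)%g.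

(* A bare pair of real functions; the constraints are in [is_ifs]. *)
Record fpair (R : realType) (S : Type) : Type :=
  FPair { mu : S -> R ; nu : S -> R }.

Section IntuitionisticFuzzySubsets.
Context (R : realType) (S : Type).
Implicit Type A : fpair R S.

Definition is_ifs A : Prop :=
  forall x : S, [/\ 0 <= mu A x <= 1, 0 <= nu A x <= 1
                  & 0 <= mu A x + nu A x <= 1].

Definition ifs_empty A : Prop := forall x : S, mu A x = 0 /\ nu A x = 1.

Definition nonempty_ifs A : Prop := is_ifs A /\ ~ ifs_empty A.

Definition magnified_translation (beta alpha : R) A : fpair R S :=
  FPair (fun x => beta * mu A x + alpha) (fun x => beta * nu A x - alpha).

End IntuitionisticFuzzySubsets.

Section IntuitionisticFuzzyIdeals.
Context (R : realType) (S : semigroupType).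
Implicit Type A : fpair R S.

Definition if_left_ideal A : Prop :=
  nonempty_ifs A /\
  forall x y : S, mu A y <= mu A (x * y)%g /\ nu A (x * y)%g <= nu A y.

Definition if_right_ideal A : Prop :=
  nonempty_ifs A /\
  forall x y : S, mu A x <= mu A (x * y)%g /\ nu A (x * y)%g <= nu A x.

Definition if_ideal A : Prop := if_left_ideal A /\ if_right_ideal A.

Definition if_semiprime_ideal A : Prop :=
  if_ideal A /\
  forall x : S, mu A (x * x)%g <= mu A x /\ nu A x <= nu A (x * x)%g.

End IntuitionisticFuzzyIdeals.

(* Main.v *)
Require Import Defs.
From mathcomp Require Import all_boot all_order all_algebra.
From mathcomp Require Import classical_sets reals.
From mathcomp Require Import boolp.
From mathcomp Require Import lra.

Import Order.TTheory GRing.Theory Num.Theory.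

Local Open Scope classical_set_scope.
Local Open Scope ring_scope.

(** If [a = u a^2 v], ideals satisfy [mu a >= mu (a^2)] and [nu a <= nu (a^2)],
    and increasing affine maps preserve these inequalities.  Conversely, apply
    (2) with [beta = 1], [alpha = 0] to the characteristic pair of the ideal
    [J = S a^2 S]: it contains [a^4], so semiprimeness used twice puts [a^2] and
    then [a] in [J]. *)

(** Nonnegativity bounds the range below, which makes its [inf] a genuine lower bound. *)
Lemma le_inf_range (R : realType) (T : Type) (f : T -> R) (c : R) (x : T) :
  (forall y, 0 <= f y) -> c <= inf [set f y | y in [set: T]] -> c <= f x.
Proof.
move=> f_ge0 /le_trans; apply; apply: ge_inf; last by exists x.
by exists 0 => _ [y _ <-].
Qed.

Lemma inf_range_ge0 (R : realType) (T : Type) (f : T -> R) :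
  [set: T] !=set0 -> (forall y, 0 <= f y) ->
  0 <= inf [set f y | y in [set: T]].
Proof.
move=> [x _] f_ge0; apply: lb_le_inf; first by exists (f x), x.
by move=> _ [y _ <-].
Qed.

Section Translation.
Context (R : realType) (S : semigroupType) (A : fpair R S) (beta alpha : R).
Hypothesis beta01 : 0 < beta <= 1.
Hypothesis alpha_inf : 0 <= alpha <= inf [set beta * nu A x | x in [set: S]].

Lemma nonempty_ifs_translation :
  nonempty_ifs A -> nonempty_ifs (magnified_translation beta alpha A).
Proof.
move=> [Aifs Ane]; have /andP[b0 b1] := beta01; have /andP[a0 ainf] := alpha_inf.
have bnu_ge0 y : 0 <= beta * nu A y.
  by have [_ /andP[nu0 _] _] := Aifs y; rewrite mulr_ge0 // ltW.
have alpha_le x : alpha <= beta * nu A x by exact: (le_inf_range _ _ _ _ x bnu_ge0).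
split=> [x | Aempty].
  have [/andP[mu0 mu1] /andP[nu0 nu1] /andP[s0 s1]] := Aifs x.
  have := alpha_le x; rewrite /magnified_translation /=.
  (* The new [mu] stays below 1 since [beta * mu + alpha <= beta * (mu + nu) <= 1]; in the sum of
     the two components [alpha] cancels. *)
  by split; apply/andP; split; nra.
apply: Ane => x; have [/andP[mu0 mu1] /andP[nu0 nu1] _] := Aifs x.
have [/= Emu Enu] := Aempty x.
(* From [beta * nu = 1 + alpha >= 1] with [beta] and [nu] at most 1. *)
have nuE : nu A x = 1 by nra.
by split=> //; nra.
Qed.

Lemma if_ideal_translation :
  if_ideal A -> if_ideal (magnified_translation beta alpha A).
Proof.
have /andP[b0 _] := beta01.
move=> [[Ane Al] [_ Ar]]; have Bne : nonempty_ifs (magnified_translation beta alpha A)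
  by exact: nonempty_ifs_translation.
by split; split=> // x y; rewrite /= lerD2r lerD2r !ler_pM2l.
Qed.

End Translation.

Lemma intra_regular_semiprime (R : realType) (S : semigroupType)
    (A : fpair R S) :
  intra_regular S -> if_ideal A -> if_semiprime_ideal A.
Proof.
move=> Sreg Aid; split=> // a; have [[_ Al] [_ Ar]] := Aid.
have [u [v aE]] := Sreg a.
have [mul nul] := Al u (a * a)%g.
have [mur nur] := Ar (u * (a * a))%g v.
by rewrite -aE in mur nur; split; [exact: le_trans mur | exact: le_trans nul].
Qed.

Section CharacteristicPair.
Context (R : realType) (S : semigroupType).

Definition char_fpair (J : set S) : fpair R S :=
  FPair (fun x => `[< J x >]%:R) (fun x => (~~ `[< J x >])%:R).

(** Between values in {0, 1} the ideal inequalities are implications of membership; a point of [J]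
    has [mu = 1], so the pair is not the empty one. *)
Lemma if_ideal_char_fpair (J : set S) :
  J !=set0 -> (forall x y, J y -> J (x * y)%g) ->
  (forall x y, J x -> J (x * y)%g) -> if_ideal (char_fpair J).
Proof.
move=> [z Jz] Jl Jr.
have Jne : nonempty_ifs (char_fpair J).
  split=> [x | /(_ z)[/= + _]].
    by rewrite /=; case: asboolP => _ /=; split; lra.
  by rewrite asboolT // => /eqP; rewrite oner_eq0.
have mono x y : (J x -> J y) -> mu (char_fpair J) x <= mu (char_fpair J) y /\
    nu (char_fpair J) y <= nu (char_fpair J) x.
  rewrite /=; case: asboolP => Jx; case: asboolP => Jy Jxy //=.
  by case: Jy; apply: Jxy.
by split; split=> // x y; apply: mono; [exact: Jl | exact: Jr].
Qed.

(** Semiprimeness gives [1 <= mu x], which excludes the value 0. *)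
Lemma char_fpair_semiprime (J : set S) (x : S) :
  if_semiprime_ideal (char_fpair J) -> J (x * x)%g -> J x.
Proof.
move=> [_ /(_ x)[/= + _]] Jxx; rewrite (asboolT Jxx).
by case: asboolP => //= _; rewrite ler10.
Qed.

End CharacteristicPair.

(** This turns condition (2) into a statement about the ideal itself. *)
Lemma magnified_translation10 (R : realType) (S : Type) (A : fpair R S) :
  magnified_translation 1 0 A = A.
Proof.
case: A => m n; rewrite /magnified_translation /=.
by congr FPair; apply/funext => x; rewrite mul1r ?addr0 ?subr0.
Qed.

Theorem theorem3p17 (R : realType) (S : semigroupType)
    (S_neq0 : [set: S] !=set0) :
  intra_regular S <->
  (forall (A : fpair R S) (beta alpha : R),
     if_ideal A ->
     0 < beta <= 1 ->
     0 <= alpha <= inf [set beta * nu A x | x in [set: S]] ->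
     if_semiprime_ideal (magnified_translation beta alpha A)).
Proof.
split=> [Sreg A beta alpha Aid b01 a_inf | semiprime a].
  by apply: intra_regular_semiprime => //; exact: if_ideal_translation.
pose J : set S := [set z | exists x y : S, z = (x * (a * a) * y)%g].
(* Without a unit [a^2] need not be visibly in [J], but [a (a^2) a] is, and it is the square of
   [a^2]. *)
have Ja4 : J ((a * a) * (a * a))%g by exists a, a; rewrite !mulgA.
have Jid : if_ideal (char_fpair R S J).
  apply: if_ideal_char_fpair => [|x _ [u [v ->]]|_ y [u [v ->]]].
  - by exists ((a * a) * (a * a))%g.
  - by exists (x * u)%g, v; rewrite !mulgA.
  - by exists u, (v * y)%g; rewrite !mulgA.
have Jsp : if_semiprime_ideal (char_fpair R S J).
  rewrite -[char_fpair R S J]magnified_translation10; apply: semiprime => //.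
    by rewrite ltr01 lexx.
  (* The choice [alpha = 0] is admissible because the infimum is nonnegative, [S] being
     non-empty. *)
  by rewrite lexx inf_range_ge0 // => y; rewrite mul1r ler0n.
(* The goal is [J a] unfolded; the two applications reduce it to [J (a^2)], then to [Ja4]. *)
by do 2!apply: (char_fpair_semiprime _ _ _ _ Jsp).
Qed.
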